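(* For all $k\ge 0$ and all graphs $G,G'$ the following are equivalent. (i) For all graphs $F$ of tree depth at most $k$, $\hom(F,G)=\hom(F,G')$. (ii) For all $D\in\mathcal D_k$, $\mathrm{pi\text{-}hom}(D,G)=\mathrm{pi\text{-}hom}(D,G')$. (iii) For all $D\in\mathcal D_k$, $\mathrm{pp\text{-}hom}(D,G)=\mathrm{pp\text{-}hom}(D,G')$.
   Context: Graphs are finite, undirected, vertex-coloured triples $(V(G),E(G),\gamma^G)$. A homomorphism preserves edges and colours; $\hom$ counts homomorphisms. A forest is a finite poset $(V,\preceq)$ in which each $\{u:u\preceq t\}$ is a chain; a tree is a forest with a unique minimal element; height = maximum number of elements in a chain. An elimination forest (tree) of a graph $F$ is a forest (tree) on $V(F)$ with $u\preceq v$ or $v\preceq u$ for every edge $uv$; the tree depth of $F$ is the minimum height of an elimination forest. $\mathcal D_k$ is the class of pairs $D=(F,T)$ with $F$ a graph (not necessarily connected) and $T$ an elimination tree of $F$ of height at most $k$; homomorphisms from $D$ are homomorphisms from $F$. A homomorphism $h:D\to H$ is past-injective if $h(u)\ne h(v)$ whenever $u\prec^T v$; it is past-preserving if moreover for all $u\preceq^T v$: $uv\in E(F)\iff h(u)h(v)\in E(H)$. $\mathrm{pi\text{-}hom}$, $\mathrm{pp\text{-}hom}$ count them. *)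

(* Defs.v *)
From HB Require Import structures.
From mathcomp Require Import all_boot.

Set Implicit Arguments.
Unset Strict Implicit.
Unset Printing Implicit Defensive.

(* Simple graphs: no loops, no parallel edges. *)
Record graph (C : eqType) := Graph {
  vertex :> finType;
  edge : rel vertex;
  colour : vertex -> C;
  edge_sym : symmetric edge;
  edge_irrefl : irreflexive edge
}.

Arguments edge {C g}.
Arguments colour {C g}.

Section Posets.

Variable V : finType.

(* A binary relation on V is a set of pairs, so that relations on V form a
   finite type. *)
Implicit Types (T : {set V * V}) (A : {set V}).

Definition ple T : rel V := fun u v => (u, v) \in T.

Definition plt T : rel V := fun u v => (u != v) && ple T u v.

Definition is_poset T : bool :=
  [&& [forall u, ple T u u],
      [forall u, forall v, ple T u v && ple T v u ==> (u == v)]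
    & [forall u, forall v, forall w, ple T u v && ple T v w ==> ple T u w]].

Definition chain T A : bool :=
  [forall u in A, forall v in A, ple T u v || ple T v u].

Definition forest T : bool :=
  is_poset T && [forall t, chain T [set u | ple T u t]].

Definition minimal T (r : V) : bool := [forall u, ple T u r ==> (u == r)].

Definition tree T : bool := forest T && (#|[set r | minimal T r]| == 1).

Definition height T : nat := \max_(A : {set V} | chain T A) #|A|.

End Posets.

Section TreeDepth.

Variables (C : eqType) (F : graph C).

Definition edges_comparable (T : {set F * F}) : bool :=
  [forall u : F, forall v : F, edge u v ==> ple T u v || ple T v u].

Definition elimination_forest (T : {set F * F}) : bool :=
  forest T && edges_comparable T.

Definition elimination_tree (T : {set F * F}) : bool :=
  tree T && edges_comparable T.

(* Any linear order on the vertices is an elimination forest. *)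
Lemma elimination_height_exists :
  exists n, [exists T : {set F * F}, elimination_forest T && (height T == n)].
Proof.
pose T := [set p : F * F | enum_rank p.1 <= enum_rank p.2].
exists (height T); apply/existsP; exists T; rewrite eqxx andbT.
have TE u v : ple T u v = (enum_rank u <= enum_rank v) by rewrite /ple inE.
have tot u v : ple T u v || ple T v u by rewrite !TE leq_total.
apply/andP; split; last first.
  by apply/forallP => u; apply/forallP => v; rewrite tot implybT.
apply/andP; split; last first.
  apply/forallP => t; apply/forall_inP => u _; apply/forall_inP => v _.
  exact: tot.
apply/and3P; split.
- by apply/forallP => u; rewrite TE.
- apply/forallP => u; apply/forallP => v; apply/implyP.
  by rewrite !TE -eqn_leq => /eqP/val_inj/enum_rank_inj ->.
- apply/forallP => u; apply/forallP => v; apply/forallP => w; apply/implyP.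
  by rewrite !TE => /andP[]; apply: leq_trans.
Qed.

Definition tree_depth : nat := ex_minn elimination_height_exists.

End TreeDepth.

Record dgraph (C : eqType) := DGraph {
  dg_graph :> graph C;
  dg_tree : {set dg_graph * dg_graph};
  dg_treeP : elimination_tree dg_tree
}.

Definition in_D (C : eqType) (k : nat) (D : dgraph C) : bool :=
  height (dg_tree D) <= k.

Definition is_hom (C : eqType) (F H : graph C) (h : {ffun F -> H}) : bool :=
  [forall u, forall v, edge u v ==> edge (h u) (h v)]
  && [forall u, colour (h u) == colour u].

Definition past_injective (C : eqType) (D : dgraph C) (H : graph C)
    (h : {ffun D -> H}) : bool :=
  is_hom h && [forall u, forall v, plt (dg_tree D) u v ==> (h u != h v)].

Definition past_preserving (C : eqType) (D : dgraph C) (H : graph C)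
    (h : {ffun D -> H}) : bool :=
  past_injective h
  && [forall u, forall v, ple (dg_tree D) u v ==>
                            (edge u v == edge (h u) (h v))].

Definition hom (C : eqType) (F H : graph C) : nat :=
  #|[set h : {ffun F -> H} | is_hom h]|.

Definition pi_hom (C : eqType) (D : dgraph C) (H : graph C) : nat :=
  #|[set h : {ffun D -> H} | past_injective h]|.

Definition pp_hom (C : eqType) (D : dgraph C) (H : graph C) : nat :=
  #|[set h : {ffun D -> H} | past_preserving h]|.

(* Main.v *)
Require Import Defs.
From mathcomp Require Import all_boot.

(* Every homomorphism from a graph with an elimination forest factors uniquely
   as a past-injective homomorphism after the quotient sending each vertex v to
   the least vertex below v with the same image; deleting the merged vertices
   does not increase the height.  So hom is pi-hom plus a sum of pi-homs from
   smaller graphs.  Similarly pi-hom is pp-hom plus a sum of pp-homs from graphs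
   with more edges between comparable vertices.  Both triangular systems can be
   inverted.  Forests reduce to trees since hom is multiplicative over disjoint
   unions. *)

Set Implicit Arguments.
Unset Strict Implicit.
Unset Printing Implicit Defensive.

(** * Counting by bijections and by fibres *)

Lemma card_set_can (X Y : finType) (P : pred X) (Q : pred Y)
    (f : X -> Y) (g : Y -> X) :
  (forall x, P x -> Q (f x)) -> (forall y, Q y -> P (g y)) ->
  {in P, cancel f g} -> {in Q, cancel g f} ->
  #|[set x | P x]| = #|[set y | Q y]|.
Proof.
move=> PQ QP fK gK.
have -> : [set y | Q y] = f @: [set x | P x].
  apply/setP=> y; rewrite inE; apply/idP/imsetP => [Qy|[x]].
    by exists (g y); rewrite ?inE ?QP ?gK.
  by rewrite inE => Px ->; apply: PQ.
rewrite card_in_imset // => x y; rewrite !inE => Px Py.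
exact: (can_in_inj fK).
Qed.

Lemma card_partition_set (X Y : finType) (P : pred X) (f : X -> Y) (Q : pred Y) :
  (forall x, P x -> Q (f x)) ->
  #|[set x | P x]| = \sum_(y | Q y) #|[set x | P x && (f x == y)]|.
Proof.
move=> PQ; rewrite cardsE -sum1_card (partition_big f Q) //=.
by apply: eq_bigr => y _; rewrite cardsE -sum1_card.
Qed.

(** * Order theory of finite forests and trees *)

Section Posets.

Variables (V : finType) (T : {set V * V}).

Lemma is_posetP :
  reflect [/\ forall u, ple T u u,
              forall u v, ple T u v -> ple T v u -> u = v
            & forall v u w, ple T u v -> ple T v w -> ple T u w]
          (is_poset T).
Proof.
apply: (iffP and3P) => [[/forallP r a t]|[r a t]]; split.
- exact: r.
- move=> u v uv vu; apply/eqP; move/forallP/(_ u)/forallP/(_ v)/implyP: a.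
  by apply; rewrite uv.
- move=> v u w uv vw.
  move/forallP/(_ u)/forallP/(_ v)/forallP/(_ w)/implyP: t.
  by apply; rewrite uv.
- exact/forallP.
- apply/forallP => u; apply/forallP => v; apply/implyP => /andP[uv vu].
  by rewrite (a u v).
- apply/forallP => u; apply/forallP => v; apply/forallP => w.
  by apply/implyP => /andP[]; apply: t.
Qed.

Lemma chainP (A : {set V}) :
  reflect {in A &, forall u v, ple T u v || ple T v u} (chain T A).
Proof.
apply: (iffP forall_inP) => [ch u v Au Av|ch u Au].
  exact: (forall_inP (ch u Au)).
by apply/forall_inP => v Av; apply: ch.
Qed.

Lemma forestP :
  reflect [/\ forall u, ple T u u,
              forall u v, ple T u v -> ple T v u -> u = v,
              forall v u w, ple T u v -> ple T v w -> ple T u w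
            & forall t u v, ple T u t -> ple T v t -> ple T u v || ple T v u]
          (forest T).
Proof.
apply: (iffP andP) => [[/is_posetP[r a t] /forallP ch]|[r a t ch]].
  split=> // x u v ux vx.
  by move/chainP: (ch x); apply; rewrite inE.
split; first exact/is_posetP.
apply/forallP => x; apply/chainP => u v; rewrite !inE; exact: ch.
Qed.

(* The number of predecessors serves as a rank function. *)
Lemma least_in_past (t : V) (P : pred V) :
  forest T -> P t ->
  exists2 m, ple T m t && P m & forall u, ple T u t -> P u -> ple T m u.
Proof.
move=> /forestP[r a tr ch] Pt.
pose Q u := ple T u t && P u.
have Qt : Q t by rewrite /Q r.
case: (@arg_minnP V t Q (fun u => #|[set w | ple T w u]|) Qt) => m mt minm.
exists m => // u ut Pu; have [mt' _] := andP mt.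
(* If [u] lies below [m], its past is contained in that of [m]; minimality of the cardinality makes
   the two pasts equal, so [m] lies below [u]. *)
case/orP: (ch t m u mt' ut) => // um.
have sub : [set w | ple T w u] \subset [set w | ple T w m].
  by apply/subsetP => w; rewrite !inE => wu; apply: tr um.
have/eqP E : [set w | ple T w u] == [set w | ple T w m].
  by rewrite eqEcard sub minm // /Q ut.
by have: m \in [set w | ple T w u]; [rewrite E inE | rewrite inE].
Qed.

(** The least element below any [v] is minimal in the whole forest, so when there is only one
    minimal element it lies below every [v]. *)
Lemma treeP :
  reflect (forest T /\ exists r, forall v, ple T r v) (tree T).
Proof.
apply: (iffP andP) => -[fT].
  move/cards1P=> [r rE]; split => //; exists r => v.
  have [m /andP[mv _] minm] := least_in_past (t := v) (P := predT) fT isT.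
  have [_ a tr _] := forestP fT.
  have : m \in [set r | minimal T r].
    rewrite inE; apply/forallP => u; apply/implyP => um; apply/eqP/a => //.
    by apply: minm => //; apply: tr mv.
  by rewrite rE inE => /eqP <-.
case=> r rmin; split => //; have [_ a _ _] := forestP fT.
apply/cards1P; exists r; apply/setP => x; rewrite !inE.
apply/forallP/eqP => [/(_ r)|-> u].
  by rewrite rmin => /eqP.
by apply/implyP => ur; apply/eqP/a.
Qed.

End Posets.

(** * Forests restricted to a subset of the vertices *)

Section Restriction.

Variables (V : finType) (T : {set V * V}) (A : pred V).

Definition restrict : {set {x | A x} * {x | A x}} :=
  [set p | ple T (val p.1) (val p.2)].

Lemma ple_restrict u v : ple restrict u v = ple T (val u) (val v).
Proof. by rewrite /ple inE. Qed.

Lemma forest_restrict : forest T -> forest restrict.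
Proof.
move=> /forestP[r a t ch]; apply/forestP; split=> [u|u v|v u w|x u v];
  rewrite !ple_restrict //.
- by move=> uv vu; apply/val_inj/a.
- exact: t.
- exact: ch.
Qed.

Lemma height_restrict : height restrict <= height T.
Proof.
apply/bigmax_leqP => B chB.
rewrite -(card_imset _ val_inj); apply: leq_bigmax_cond.
apply/chainP => _ _ /imsetP[u Bu ->] /imsetP[v Bv ->].
by rewrite -!ple_restrict; apply: (chainP _ _ chB).
Qed.

End Restriction.

(** * Homomorphisms and the three ways of counting them *)

Section Homs.

Variable C : eqType.
Implicit Types F H : graph C.

Lemma is_homP F H (h : {ffun F -> H}) :
  reflect ((forall u v, edge u v -> edge (h u) (h v)) /\
           (forall u, colour (h u) = colour u)) (is_hom h).
Proof.
apply: (iffP andP) => [[/forallP e /forallP c]|[e c]]; split.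
- by move=> u v; apply/implyP; move/forallP: (e u); apply.
- by move=> u; apply/eqP.
- by apply/forallP => u; apply/forallP => v; apply/implyP/e.
- by apply/forallP => u; apply/eqP.
Qed.

Lemma edges_comparableP F (T : {set F * F}) :
  reflect (forall u v, edge u v -> ple T u v || ple T v u)
          (edges_comparable T).
Proof.
apply: (iffP forallP) => [e u v|e u].
  by apply/implyP; move/forallP: (e u); apply.
by apply/forallP => v; apply/implyP/e.
Qed.

Lemma tree_depth_leP F k :
  reflect (exists2 T : {set F * F}, elimination_forest T & height T <= k)
          (tree_depth F <= k).
Proof.
rewrite /tree_depth; case: ex_minnP => n exT minT.
apply: (iffP idP) => [hT|[T eT hT]].
  by have /existsP[T /andP[eT /eqP E]] := exT; exists T; rewrite ?E.
by apply: leq_trans hT; apply: minT; apply/existsP; exists T; rewrite eT /=.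
Qed.

Definition separates F H (T : {set F * F}) (h : {ffun F -> H}) : bool :=
  [forall u, forall v, plt T u v ==> (h u != h v)].

Lemma separatesP F H (T : {set F * F}) (h : {ffun F -> H}) :
  reflect (forall u v, ple T u v -> h u = h v -> u = v) (separates T h).
Proof.
apply: (iffP forallP) => [s u v uv huv|s u].
  apply/eqP/negPn/negP => nuv.
  by move/forallP/(_ v)/implyP: (s u); rewrite /plt nuv uv huv eqxx => /(_ isT).
apply/forallP => v; apply/implyP => /andP[nuv uv].
by apply: contraNneq nuv => /(s u v uv) ->.
Qed.

Definition reflects F H (T : {set F * F}) (h : {ffun F -> H}) : bool :=
  [forall u, forall v, ple T u v ==> (edge u v == edge (h u) (h v))].

Lemma reflectsP F H (T : {set F * F}) (h : {ffun F -> H}) :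
  reflect (forall u v, ple T u v -> edge u v = edge (h u) (h v))
          (reflects T h).
Proof.
apply: (iffP forallP) => [s u v uv|s u].
  by apply/eqP; move/forallP/(_ v)/implyP: (s u); apply.
by apply/forallP => v; apply/implyP => /(s u v) ->.
Qed.

(** [pi_count] and [pp_count] take a bare relation, so that graph and order can vary before the
    order is known to be an elimination tree. On a [dgraph] they unfold to [pi_hom] and [pp_hom]. *)
Definition pi_count F (T : {set F * F}) H : nat :=
  #|[set h : {ffun F -> H} | is_hom h && separates T h]|.

Definition pp_count F (T : {set F * F}) H : nat :=
  #|[set h : {ffun F -> H} | is_hom h && separates T h && reflects T h]|.

(** * Quotients along the past *)

Section Quotient.

Variables (F : graph C) (T : {set F * F}).
Hypothesis eT : elimination_forest T.

Let fT : forest T. Proof. by case/andP: eT. Qed.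
Let cT : edges_comparable T. Proof. by case/andP: eT. Qed.

Section QuotientGraph.

Variable rho : {ffun F -> F}.

(** The classes of the quotient are represented by the fixed points of [rho]. Excluding [x = y]
    gives a loopless graph for an arbitrary [rho]. *)
Definition quotient_edge : rel {x | rho x == x} := fun x y =>
  (x != y) &&
  [exists u, exists v, [&& edge u v, rho u == val x & rho v == val y]].

Lemma quotient_edgeP x y :
  reflect (x != y /\ exists u v, [/\ edge u v, rho u = val x & rho v = val y])
          (quotient_edge x y).
Proof.
apply: (iffP andP) => -[nxy].
  move/existsP=> [u /existsP[v /and3P[uv /eqP ux /eqP vy]]].
  by split=> //; exists u, v.
move=> [u [v [uv ux vy]]]; split=> //.
by apply/existsP; exists u; apply/existsP; exists v; rewrite uv ux vy !eqxx.
Qed.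

Lemma quotient_edge_sym : symmetric quotient_edge.
Proof.
suff S x y : quotient_edge x y -> quotient_edge y x.
  by move=> x y; apply/idP/idP; apply: S.
move=> /quotient_edgeP[nxy [u [v [uv ux vy]]]].
by apply/quotient_edgeP; rewrite eq_sym; split=> //; exists v, u; rewrite edge_sym.
Qed.

Lemma quotient_edge_irrefl : irreflexive quotient_edge.
Proof. by move=> x; rewrite /quotient_edge eqxx. Qed.

Definition quotient : graph C :=
  @Graph C {x | rho x == x} quotient_edge (fun x => colour (val x))
    quotient_edge_sym quotient_edge_irrefl.

Definition quotient_tree : {set quotient * quotient} :=
  restrict T (fun x => rho x == x).

(** These conditions hold for the representative map of every homomorphism; the maps satisfying them
    index the sum in [hom_quotients]. *)
Definition past_retraction : bool :=
  [&& [forall v, ple T (rho v) v], [forall v, rho (rho v) == rho v],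
      [forall v, colour (rho v) == colour v]
    & [forall u, forall v, edge u v ==> (rho u != rho v)]].

Lemma past_retractionP :
  reflect [/\ forall v, ple T (rho v) v, forall v, rho (rho v) = rho v,
              forall v, colour (rho v) = colour v
            & forall u v, edge u v -> rho u != rho v] past_retraction.
Proof.
apply: (iffP and4P) => [[/forallP le /forallP id /forallP c /forallP e]|[le id c e]];
  split=> //.
- by move=> v; apply/eqP.
- by move=> v; apply/eqP.
- by move=> u v; apply/implyP; move/forallP: (e u); apply.
- exact/forallP.
- by apply/forallP => v; apply/eqP.
- by apply/forallP => v; apply/eqP.
- by apply/forallP => u; apply/forallP => v; apply/implyP/e.
Qed.

Hypothesis retr : past_retraction.

(** For an edge [uv] with [u] below [v], both [rho u] and [rho v] lie in the past of [v], which is a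
    chain. *)
Lemma elimination_forest_quotient : elimination_forest quotient_tree.
Proof.
have [le id _ _] := past_retractionP retr.
have [_ _ tr ch] := forestP _ fT.
apply/andP; split; first exact: forest_restrict.
apply/edges_comparableP => x y /quotient_edgeP[_ [u [v [uv ux vy]]]].
rewrite !ple_restrict -ux -vy.
case/orP: (edges_comparableP _ cT u v uv) => le_uv.
  by apply: (ch v); rewrite ?le //; apply: tr le_uv.
by apply: (ch u); rewrite ?le //; apply: tr le_uv.
Qed.

Lemma elimination_tree_quotient : tree T -> elimination_tree quotient_tree.
Proof.
have [le _ _ _] := past_retractionP retr.
have [fq cq] := andP elimination_forest_quotient.
move=> /treeP[_ [r rmin]]; apply/andP; split=> //.
apply/treeP; split=> //.
(* The root has only itself in its past, so it is a fixed point and survives as the root of the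
   quotient. *)
have rr : rho r == r.
  by have [_ a _ _] := forestP _ fT; apply/eqP/a.
by exists (exist _ r rr) => v; rewrite ple_restrict /=.
Qed.

Lemma card_quotient : rho != [ffun v => v] -> #|quotient| < #|F|.
Proof.
move=> nid; rewrite card_sig; apply: proper_card; apply/properP.
split; first exact/subsetP.
have /existsP[v nv] : [exists v, rho v != v].
  rewrite -negb_forall; apply: contraNN nid => /forallP id.
  by apply/eqP/ffunP => v; rewrite ffunE; apply/eqP.
by exists v => //; rewrite inE.
Qed.

End QuotientGraph.

Section Representative.

Variables (H : graph C) (h : {ffun F -> H}).

Lemma past_repr_exists v :
  exists m, [&& ple T m v, h m == h v
              & [forall u, ple T u v && (h u == h v) ==> ple T m u]].
Proof.
have [m /andP[mv hm] minm] :=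
  least_in_past (t := v) (P := fun u => h u == h v) fT (eqxx _).
exists m; rewrite mv hm /=; apply/forallP => u; apply/implyP => /andP[].
exact: minm.
Qed.

Definition past_repr : {ffun F -> F} := [ffun v => xchoose (past_repr_exists v)].

Lemma past_reprP v :
  [/\ ple T (past_repr v) v, h (past_repr v) = h v
    & forall u, ple T u v -> h u = h v -> ple T (past_repr v) u].
Proof.
rewrite ffunE; case/and3P: (xchooseP (past_repr_exists v)) => le /eqP e /forallP m.
by split=> // u uv huv; apply: (implyP (m u)); rewrite uv huv eqxx.
Qed.

Lemma past_reprE v m :
  ple T m v -> h m = h v -> (forall u, ple T u v -> h u = h v -> ple T m u) ->
  past_repr v = m.
Proof.
move=> mv hm minm; have [le e min] := past_reprP v.
by have [_ a _ _] := forestP _ fT; apply: a; [apply: min | apply: minm].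
Qed.

Lemma past_retraction_repr : is_hom h -> past_retraction past_repr.
Proof.
move=> /is_homP[he hc]; have [r a tr ch] := forestP _ fT.
apply/past_retractionP; split=> [v|v|v|u v uv].
- by have [] := past_reprP v.
- have [le e min] := past_reprP v.
  apply: past_reprE => // u uv hu; apply: min; last by rewrite hu.
  exact: tr le.
- by have [_ e _] := past_reprP v; rewrite -hc e hc.
- have [_ eu _] := past_reprP u; have [_ ev _] := past_reprP v.
  (* Merging the ends of an edge would produce a loop in [H]. *)
  apply: contraTneq (he _ _ uv) => E.
  by rewrite -eu E ev edge_irrefl.
Qed.

(** Identifies the fibre over the trivial retraction: nothing is merged exactly when [h] is
    injective along the past. *)
Lemma past_repr_id : (past_repr == [ffun v => v]) = separates T h.
Proof.
have [r a tr ch] := forestP _ fT.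
apply/eqP/separatesP => [E u v uv huv|inj].
  have [_ _ min] := past_reprP v.
  by apply: a => //; have := min u uv huv; rewrite E ffunE.
apply/ffunP => v; rewrite [RHS]ffunE; apply: past_reprE => // u uv.
by move=> /(inj _ _ uv) ->.
Qed.

End Representative.

(** The bijection restricts [h] to the fixed points of [rho] in one direction and composes [g] with
    [rho] in the other. *)
Lemma card_hom_past_repr H (rho : {ffun F -> F}) :
  past_retraction rho ->
  #|[set h : {ffun F -> H} | is_hom h && (past_repr h == rho)]|
    = pi_count (quotient_tree rho) H.
Proof.
move=> retr; have [le id col nadj] := past_retractionP _ retr.
have [r a tr ch] := forestP _ fT.
have idb v : rho (rho v) == rho v by rewrite id.
pose proj v : quotient rho := exist _ (rho v) (idb v).
pose down (h : {ffun F -> H}) : {ffun quotient rho -> H} := [ffun x => h (val x)].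
pose up (g : {ffun quotient rho -> H}) : {ffun F -> H} := [ffun v => g (proj v)].
apply: (@card_set_can _ _ _ _ down up) => [h|g|h|g].
- move=> /andP[/is_homP[he hc] /eqP E].
  have rP v : h (rho v) = h v /\
      forall u, ple T u v -> h u = h v -> ple T (rho v) u.
    by rewrite -E; have [] := past_reprP h v.
  apply/andP; split.
    apply/is_homP; split=> [x y /quotient_edgeP[_ [u [v [uv ux vy]]]]|x].
      rewrite !ffunE -ux -vy.
      by have [-> _] := rP u; have [-> _] := rP v; apply: he.
    by rewrite ffunE hc.
  apply/separatesP => x y; rewrite ple_restrict !ffunE => xy hxy.
  (* A vertex of the quotient is its own representative, hence the least vertex of its past with its
     image. *)
  have [_ min] := rP (val y).
  by apply/val_inj/a => //; rewrite -(eqP (valP y)); apply: min.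
- move=> /andP[/is_homP[ge gc] /separatesP inj].
  apply/andP; split.
    apply/is_homP; split=> [u v uv|u]; rewrite !ffunE.
      apply: ge; apply/quotient_edgeP; split; last by exists u, v.
      by rewrite -val_eqE /= nadj.
    by rewrite gc /= col.
  apply/eqP/ffunP => v; apply: past_reprE => [||u uv]; rewrite ?le //.
    by rewrite !ffunE; congr (g _); apply: val_inj => /=.
  rewrite !ffunE => guv.
  (* Both [rho u] and [rho v] lie in the past of [v], hence are comparable; as [g] agrees on them
     and separates comparable vertices, they coincide, and [rho u] is below [u]. *)
  have ru : ple T (rho u) v by apply: tr uv.
  have E : proj u = proj v.
    case/orP: (ch v _ _ ru (le v)) => [c|c].
      by apply: inj => //; rewrite ple_restrict.
    by apply/esym/inj => //; rewrite ple_restrict.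
  by have /= <- := congr1 val E.
- move=> /andP[_ /eqP E]; apply/ffunP => v; rewrite !ffunE /= -E.
  by have [] := past_reprP h v.
- move=> _; apply/ffunP => x; rewrite !ffunE; congr (g _); apply: val_inj => /=.
  exact/eqP/(valP x).
Qed.

Lemma hom_quotients H :
  hom F H = pi_count T H +
    \sum_(rho | past_retraction rho && (rho != [ffun v => v]))
      pi_count (quotient_tree rho) H.
Proof.
have Pid : past_retraction [ffun v => v].
  have [r _ _ _] := forestP _ fT.
  apply/past_retractionP; split=> [v|v|v|u v uv]; rewrite !ffunE //.
  by apply: contraTneq uv => ->; rewrite edge_irrefl.
rewrite /hom (card_partition_set (f := @past_repr H) (@past_retraction_repr H)).
rewrite (bigD1 [ffun v => v]) //=; congr (_ + _).
  by apply: eq_card => h; rewrite !inE past_repr_id.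
by apply: eq_bigr => rho /andP[retr _]; apply: card_hom_past_repr.
Qed.

End Quotient.

(** * Adding edges along the past *)

Section Supergraph.

Variables (F : graph C) (T : {set F * F}).
Hypothesis cT : edges_comparable T.

Definition edge_set (E : rel F) : {set F * F} := [set p | E p.1 p.2].

Section AddEdges.

Variable S : {set F * F}.

(** Symmetrised and stripped of loops, so that every [S] yields a graph and sums can range over the
    finite type of sets of pairs. *)
Definition set_edge : rel F := fun u v =>
  (u != v) && (((u, v) \in S) || ((v, u) \in S)).

Lemma set_edge_sym : symmetric set_edge.
Proof. by move=> u v; rewrite /set_edge eq_sym orbC. Qed.

Lemma set_edge_irrefl : irreflexive set_edge.
Proof. by move=> u; rewrite /set_edge eqxx. Qed.

Definition with_edges : graph C :=
  @Graph C F set_edge colour set_edge_sym set_edge_irrefl.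

Definition with_edges_tree : {set with_edges * with_edges} := T.

(** The middle clause says that [S] is the edge relation it generates, so each supergraph is
    represented by exactly one [S]. *)
Definition past_supergraph : bool :=
  [forall u, forall v,
    [&& edge u v ==> ((u, v) \in S), ((u, v) \in S) == set_edge u v
      & ((u, v) \in S) ==> ple T u v || ple T v u]].

Lemma past_supergraphP :
  reflect (forall u v, [/\ edge u v -> (u, v) \in S, ((u, v) \in S) = set_edge u v
             & (u, v) \in S -> ple T u v || ple T v u])
          past_supergraph.
Proof.
apply: (iffP forallP) => [s u v|s u].
  by have /and3P[/implyP ? /eqP ? /implyP ?] := forallP (s u) v.
by apply/forallP => v; apply/and3P; have [? ? ?] := s u v; split;
  [apply/implyP|apply/eqP|apply/implyP].
Qed.

Lemma elimination_tree_with_edges :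
  tree T -> past_supergraph -> elimination_tree with_edges_tree.
Proof.
move=> tT /past_supergraphP sup; apply/andP; split=> //.
apply/edges_comparableP => u v uv; have [_ E c] := sup u v.
by apply: c; rewrite E.
Qed.

End AddEdges.

(** The edge set that turns [h] into a past-preserving map: non-edges between comparable vertices
    that [h] sends to edges are filled in. *)
Definition pulled_edges H (h : {ffun F -> H}) : {set F * F} :=
  [set p | (ple T p.1 p.2 || ple T p.2 p.1) && edge (h p.1) (h p.2)].

Lemma past_supergraph_pulled H (h : {ffun F -> H}) :
  is_hom h -> past_supergraph (pulled_edges h).
Proof.
move=> /is_homP[he _]; apply/past_supergraphP => u v; split.
- by move=> uv; rewrite inE /= he // (edges_comparableP _ cT).
- rewrite /set_edge !inE /= [ple T v u || _]orbC [edge (h v) _]edge_sym orbb.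
  by case: eqP => // ->; rewrite edge_irrefl andbF.
- by rewrite inE => /andP[].
Qed.

(** Both sides count the same functions, since adding edges leaves the vertices and the order
    unchanged: pulling back to [S] means preserving and reflecting the edges of [S] along the
    past. *)
Lemma card_pi_pulled H (S : {set F * F}) :
  past_supergraph S ->
  #|[set h : {ffun F -> H} | is_hom h && separates T h && (pulled_edges h == S)]|
    = pp_count (with_edges_tree S) H.
Proof.
move=> /past_supergraphP sup; apply: eq_card => h; rewrite !inE.
apply/andP/andP => -[/andP[/is_homP[he hc] sh]].
  move=> /eqP E.
  have eE u v : set_edge S u v = (ple T u v || ple T v u) && edge (h u) (h v).
    by have [_ <- _] := sup u v; rewrite -E inE.
  split; last first.
    by apply/reflectsP => u v uv; rewrite [LHS]eE [ple T u v]uv.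
  apply/andP; split; last exact: sh.
  by apply/is_homP; split=> // u v; rewrite [edge u v]eE => /andP[].
move=> /reflectsP re; split.
  apply/andP; split; last exact: sh.
  apply/is_homP; split=> // u v uv; apply: he.
  by have [i E _] := sup u v; rewrite /= -E; apply: i.
apply/eqP/setP => -[u v]; rewrite inE /=; have [_ E c] := sup u v.
apply/andP/idP => [[/orP[le|le] e]|uv].
- by rewrite E; apply: etrans (re u v le) e.
- by rewrite E set_edge_sym; apply: etrans (re v u le) _; rewrite edge_sym.
- split; first exact: c.
  by apply: he; rewrite /= -E.
Qed.

(** Partition by pulled-back edge set; the fibre over the edges of [F] itself consists of the
    past-preserving maps. *)
Lemma pi_supergraphs H :
  pi_count T H = pp_count T H +
    \sum_(S | past_supergraph S && (S != edge_set edge))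
      pp_count (with_edges_tree S) H.
Proof.
have PE : past_supergraph (edge_set edge).
  apply/past_supergraphP => u v; rewrite /set_edge !inE /=; split=> //.
    rewrite [edge v u]edge_sym orbb.
    by case: eqP => // ->; rewrite edge_irrefl.
  exact: (edges_comparableP _ cT).
rewrite /pi_count (@card_partition_set _ _ _ (@pulled_edges H) past_supergraph); last first.
  by move=> h /andP[hh _]; apply: past_supergraph_pulled.
rewrite (bigD1 (edge_set edge)) //=; congr (_ + _).
  apply: eq_card => h; rewrite !inE; case hh: (is_hom h) => //=.
  congr (_ && _); move/is_homP: hh => [he _].
  apply/eqP/reflectsP => [E u v uv|re].
    by move/setP/(_ (u, v)): E; rewrite !inE /= uv.
  apply/setP => -[u v]; rewrite !inE /=.
  apply/andP/idP => [[/orP[le|le] e]|uv].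
  - by rewrite re.
  - by rewrite edge_sym re // edge_sym.
  - by rewrite he // (edges_comparableP _ cT).
by apply: eq_bigr => S /andP[sup _]; apply: card_pi_pulled.
Qed.

(** Provides the decreasing measure for inverting [pi_supergraphs]. *)
Lemma card_non_edges_lt S :
  past_supergraph S -> S != edge_set edge ->
  #|~: edge_set (@edge C (with_edges S))| < #|~: edge_set (@edge C F)|.
Proof.
move=> /past_supergraphP sup nS.
have -> : edge_set (@edge C (with_edges S)) = S.
  by apply/setP => -[u v]; rewrite inE /=; have [_ -> _] := sup u v.
apply: proper_card; rewrite properEneq (inj_eq (@setC_inj _)) nS /= setCS.
by apply/subsetP => -[u v]; rewrite inE /=; have [i _ _] := sup u v.
Qed.

End Supergraph.

(** * Components of a forest *)

Section Induced.

Variables (F : graph C) (T : {set F * F}).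

Definition induced (A : pred F) : graph C :=
  @Graph C {x | A x} (fun x y => edge (val x) (val y)) (fun x => colour (val x))
    (fun x y => edge_sym _ _) (fun x => edge_irrefl _).

Definition induced_tree A : {set induced A * induced A} := restrict T A.

Lemma elimination_forest_induced A :
  elimination_forest T -> elimination_forest (induced_tree A).
Proof.
move=> /andP[fT /edges_comparableP cT]; apply/andP; split.
  exact: forest_restrict.
by apply/edges_comparableP => u v uv; rewrite !ple_restrict; apply: cT.
Qed.

Lemma card_induced (A : pred F) v : ~~ A v -> #|induced A| < #|F|.
Proof.
move=> nAv; rewrite card_sig; apply: proper_card; apply/properP.
split; first exact/subsetP.
by exists v; rewrite // inE.
Qed.

(** No edge leaves [A], so homomorphisms on [A] and on its complement can be chosen independently
    and glued. *)
Lemma hom_disconnected (A : pred F) H :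
  (forall u v, edge u v -> A u = A v) ->
  hom F H = hom (induced A) H * hom (induced (predC A)) H.
Proof.
move=> cl; rewrite /hom -cardsX.
pose down (h : {ffun F -> H}) :
    {ffun induced A -> H} * {ffun induced (predC A) -> H} :=
  ([ffun x => h (val x)], [ffun x => h (val x)]).
(* An informative case split, whose branches supply the membership proofs that the subtypes
   require. *)
have dec (b : bool) : {b} + {~~ b} by case: b; [left | right].
pose glue (g : {ffun induced A -> H} * {ffun induced (predC A) -> H}) v :=
  match dec (A v) with
  | left Av => g.1 (exist _ v Av)
  | right nAv => g.2 (exist (fun x => predC A x) v nAv)
  end.
have glueA g v (Av : A v) : glue g v = g.1 (exist _ v Av).
  rewrite /glue; case: (dec _) => [Av'|nAv]; last by case/negP: (nAv).
  by congr (g.1 _); apply: val_inj.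
have glueC g v (Av : predC A v) : glue g v = g.2 (exist _ v Av).
  rewrite /glue; case: (dec _) => [Av'|nAv]; first by case/negP: (Av).
  by congr (g.2 _); apply: val_inj.
pose up g : {ffun F -> H} := [ffun v => glue g v].
pose Q (g : {ffun induced A -> H} * {ffun induced (predC A) -> H}) :=
  is_hom g.1 && is_hom g.2.
rewrite (@card_set_can _ _ _ Q down up).
- by apply: eq_card => g; rewrite !inE.
- move=> h /is_homP[he hc]; apply/andP; split; apply/is_homP; split=> *;
    rewrite !ffunE; by [apply: he | apply: hc].
- move=> g /andP[/is_homP[e1 c1] /is_homP[e2 c2]].
  apply/is_homP; split=> [u v uv|v]; rewrite !ffunE.
    case Au: (A u).
      by have Av := Au; rewrite (cl _ _ uv) in Av; rewrite !glueA; apply: e1.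
    have Av := Au; rewrite (cl _ _ uv) in Av.
    by rewrite !glueC /= ?Au ?Av // => *; apply: e2.
  case Av: (A v); first by rewrite glueA c1.
  by rewrite glueC /= ?Av // => ?; rewrite c2.
- move=> h _; apply/ffunP => v; rewrite !ffunE.
  case Av: (A v); first by rewrite glueA ffunE.
  by rewrite glueC /= ?Av // => ?; rewrite ffunE.
- move=> [g1 g2] _; congr (_, _); apply/ffunP => -[x Ax]; rewrite !ffunE /=.
    by rewrite glueA.
  by rewrite glueC.
Qed.

End Induced.

(* A forest that is not a tree splits off the up-set of a minimal element. *)
Lemma hom_eq_of_trees k (G G' : graph C) :
  (forall F (T : {set F * F}), elimination_tree T -> height T <= k ->
     hom F G = hom F G') ->
  forall F (T : {set F * F}), elimination_forest T -> height T <= k ->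
    hom F G = hom F G'.
Proof.
move=> trees F; move: {2}#|F| (leqnn #|F|) => n.
elim: n F => [|n IH] F leF T eT hT.
  (* Without vertices there is a single function into either target, and it is a homomorphism. *)
  have F0 (x : F) : False by move: leF; rewrite leqNgt (cardD1 x).
  rewrite /hom !(eq_card (B := predT)) ?card_ffun; last 2 first.
  - by move=> h; rewrite !inE; apply/is_homP; split=> x; case: (F0 x).
  - by move=> h; rewrite !inE; apply/is_homP; split=> x; case: (F0 x).
  by move: leF; rewrite leqn0 => /eqP->; rewrite !expn0.
have [fT cT] := andP eT; have [r a tr ch] := forestP _ fT.
case: (pickP F) => [x _|F0]; last first.
  (* The empty forest has no minimal element and so is not a tree; it falls under the induction
     hypothesis. *)
  by apply: (IH F) hT => //; rewrite eq_card0.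
have [m /andP[mx _] minm] := least_in_past (t := x) (P := predT) fT isT.
have mmin u : ple T u m -> u = m.
  by move=> um; apply: a => //; apply: minm => //; apply: tr mx.
pose A : pred F := ple T m.
case: (altP (@forallP _ A)) => [mleast|].
  apply: (trees F T) => //; apply/andP; split=> //.
  by apply/treeP; split=> //; exists m.
rewrite negb_forall => /existsP[v nAv].
have cl u w : edge u w -> A u = A w.
  (* If [m] and [y] are both below [z], they are comparable, and minimality of [m] leaves only [m]
     below [y]. Hence the up-set of [m] is closed under comparability. *)
  have half y z : ple T y z -> A y = A z.
    move=> yz; apply/idP/idP => [my|mz]; first exact: tr yz.
    by case/orP: (ch z m y mz yz) => // /mmin ->; apply: r.
  by move=> /(edges_comparableP _ cT)/orP[/half|/half].
(* [A] misses [v] and its complement misses [m], so both factors come from smaller graphs. *)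
rewrite !(hom_disconnected _ cl); congr (_ * _).
  apply: (IH _ _ (induced_tree T A)).
  - by rewrite -ltnS; apply: leq_trans (card_induced nAv) leF.
  - exact: elimination_forest_induced.
  - exact: leq_trans (height_restrict _ _) hT.
have nAm : ~~ predC A m by rewrite /= negbK; apply: r.
apply: (IH _ _ (induced_tree T (predC A))).
- by rewrite -ltnS; apply: leq_trans (card_induced nAm) leF.
- exact: elimination_forest_induced.
- exact: leq_trans (height_restrict _ _) hT.
Qed.

(** * Transferring equalities between the three counts *)

Lemma elimination_tree_forest F (T : {set F * F}) :
  elimination_tree T -> elimination_forest T.
Proof. by case/andP => /andP[fT _] cT; apply/andP. Qed.

(** Induction on the number of vertices: the nontrivial quotients are smaller, so their terms agree
    and cancel from [hom_quotients]. *)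
Lemma pi_eq_of_hom k (G G' : graph C) :
  (forall F, tree_depth F <= k -> hom F G = hom F G') ->
  forall F (T : {set F * F}), elimination_tree T -> height T <= k ->
    pi_count T G = pi_count T G'.
Proof.
move=> homs F; move: {2}#|F|.+1 (ltnSn #|F|) => n.
elim: n F => // n IH F ltF T eT hT.
have eT' := elimination_tree_forest eT.
have: hom F G = hom F G' by apply/homs/tree_depth_leP; exists T.
rewrite !(hom_quotients eT').
rewrite [X in _ + X = _](eq_bigr (fun rho => pi_count (quotient_tree T rho) G')).
  by move/addIn.
move=> rho /andP[retr nid]; apply: IH.
- exact: leq_trans (card_quotient nid) ltF.
- by apply: elimination_tree_quotient => //; case/andP: eT.
- exact: leq_trans (height_restrict _ _) hT.
Qed.

(** After the reduction to trees, the terms of [hom_quotients] agree one by one, as quotients of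
    trees are trees of no larger height. *)
Lemma hom_eq_of_pi k (G G' : graph C) :
  (forall F (T : {set F * F}), elimination_tree T -> height T <= k ->
     pi_count T G = pi_count T G') ->
  forall F, tree_depth F <= k -> hom F G = hom F G'.
Proof.
move=> pis F /tree_depth_leP[T eT hT].
apply: (hom_eq_of_trees (k := k)) eT hT => {F T} F T eT hT.
rewrite !(hom_quotients (elimination_tree_forest eT)) (pis _ T) //; congr (_ + _).
apply: eq_bigr => rho /andP[retr _]; apply: pis.
  apply: elimination_tree_quotient => //; last by case/andP: eT.
  exact: elimination_tree_forest.
exact: leq_trans (height_restrict _ _) hT.
Qed.

(** Induction on the number of non-adjacent ordered pairs. The order, and with it the height, stays
    fixed while edges are added. *)
Lemma pp_eq_of_pi k (G G' : graph C) :
  (forall F (T : {set F * F}), elimination_tree T -> height T <= k ->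
     pi_count T G = pi_count T G') ->
  forall F (T : {set F * F}), elimination_tree T -> height T <= k ->
    pp_count T G = pp_count T G'.
Proof.
move=> pis F; move: {2}#|_|.+1 (ltnSn #|~: edge_set (@edge C F)|) => n.
elim: n F => // n IH F ltF T eT hT; have [tT cT] := andP eT.
have := pis F T eT hT; rewrite !(pi_supergraphs cT).
rewrite [X in _ + X = _](eq_bigr (fun S => pp_count (with_edges_tree T S) G')).
  by move/addIn.
move=> S /andP[sup nS]; apply: IH => //.
- exact: leq_trans (card_non_edges_lt sup nS) ltF.
- exact: elimination_tree_with_edges.
Qed.

Lemma pi_eq_of_pp k (G G' : graph C) :
  (forall F (T : {set F * F}), elimination_tree T -> height T <= k ->
     pp_count T G = pp_count T G') ->
  forall F (T : {set F * F}), elimination_tree T -> height T <= k ->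
    pi_count T G = pi_count T G'.
Proof.
move=> pps F T eT hT; have [tT cT] := andP eT.
rewrite !(pi_supergraphs cT) (pps F T) //; congr (_ + _).
apply: eq_bigr => S /andP[sup _]; apply: pps => //.
exact: elimination_tree_with_edges.
Qed.

End Homs.

Theorem theorem15 (C : eqType) (k : nat) (G G' : graph C) :
  [<-> (forall F : graph C, tree_depth F <= k -> hom F G = hom F G');
       (forall D : dgraph C, in_D k D -> pi_hom D G = pi_hom D G');
       (forall D : dgraph C, in_D k D -> pp_hom D G = pp_hom D G')].
Proof.
tfae.
- by move=> homs [F T eT] hT; apply: (pi_eq_of_hom homs).
- move=> pis [F T eT] hT; apply: (pp_eq_of_pi (k := k)) => // F' T' eT' hT'.
  exact: (pis (DGraph eT')).
(* The cycle closes by way of the past-injective counts. *)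
- move=> pps; apply: hom_eq_of_pi; apply: pi_eq_of_pp => F T eT hT.
  exact: (pps (DGraph eT)).
Qed.
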